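(* For positive integers $k$, the following holds for the numbers $d_k(m)$ of partitions of $m$ into distinct parts, all of size at most $k$: (i) For $k\ge 1$, $d_k(0)=d_k(1)=1$. (ii) For $k\ge 2$, $d_k(2)=1$; moreover $d_2(3)=1$ and $d_3(4)=1$. (iii) For $k\ge 4$, $d_k(3)=d_k(4)=2$. (iv) For $k\in\{4,\ldots,11\}$, further equalities $d_k(m-1)=d_k(m)$ hold for the following values of $m\le k(k+1)/4$: $k=4$: $m=5$; $k=5$: $m=6,7$; $k=6$: $m=7,8,10$; $k=7$: $m=8,11,13,14$; $k=8$: $m=16,17$; $k=9$: $m=19,22$; $k=10$: $m=26$; $k=11$: $m=32$. (v) For $k\ge 12$, $d_k(m-1)<d_k(m)$ for all $m$ with $5\le m\le k(k+1)/4$. Moreover, for every $k\geq 1$, up to equalities deduced from those in items (i)–(iv) by the symmetry $d_k(m)=d_k\big(\tfrac{k(k+1)}2-m\big)$ of the sequence (including the equality of the two middle terms when $k\equiv 1$ or $2 \pmod 4$), all equalities $d_k(m-1)=d_k(m)$ between consecutive terms of the sequence $(d_k(m))_{0\le m\le k(k+1)/2}$ are those given by items (i)–(iv), namely: $m=1$ for $k\ge 1$; $m=2$ for $k\ge 2$; $m=3$ for $k=2$; $m=4$ for $k\ge 4$; and, for $k\in\{4,\ldots,11\}$, the values of $m$ listed in item (iv).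
   Context: For integers $k\ge 1$ and $m\ge 0$, $d_k(m)$ is the number of partitions of $m$ into pairwise distinct positive parts with largest part at most $k$ (with $d_k(0)=1$); equivalently $\prod_{i=1}^k(1+x^i)=\sum_{m=0}^{k(k+1)/2}d_k(m)x^m$. *)

(* Defs.v *)
From mathcomp Require Import all_boot.

Set Implicit Arguments.
Unset Strict Implicit.
Unset Printing Implicit Defensive.

(* A partition into pairwise distinct parts is identified with its set of
   parts, here a set of positive integers at most k. *)
Definition distinct_partitions (k m : nat) : {set {set 'I_k.+1}} :=
  [set A : {set 'I_k.+1} | (ord0 \notin A) && (\sum_(i in A) i == m)].

Definition d (k m : nat) : nat := #|distinct_partitions k m|.

(* k * k.+1 is even, so the halving is exact. *)
Definition max_weight (k : nat) : nat := (k * k.+1)./2.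

Definition sporadic (k : nat) : seq nat :=
  match k with
  | 4 => [:: 5]
  | 5 => [:: 6; 7]
  | 6 => [:: 7; 8; 10]
  | 7 => [:: 8; 11; 13; 14]
  | 8 => [:: 16; 17]
  | 9 => [:: 19; 22]
  | 10 => [:: 26]
  | 11 => [:: 32]
  | _ => [::]
  end.

Definition listed (k m : nat) : bool :=
  [|| (1 <= k) && (m == 1), (2 <= k) && (m == 2), (k == 2) && (m == 3),
      (4 <= k) && (m == 4) | (4 <= k <= 11) && (m \in sporadic k)].

(* The equality d k m.-1 = d k m is carried by the symmetry to the one at
   (max_weight k).+1 - m; the two middle terms, present when max_weight k is
   odd, are exchanged by it. *)
Definition listed_up_to_symmetry (k m : nat) : Prop :=
  [\/ listed k m,
      listed k ((max_weight k).+1 - m)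
    | (k = 1 %[mod 4] \/ k = 2 %[mod 4]) /\ 2 * m = (max_weight k).+1].

(* Main.v *)
(* The generating polynomial gives d (k+1) m = d k m + d k (m - k - 1), so
   strict growth for k passes to k + 1 as long as m <= k (k + 1) / 4.  For the
   remaining m, at distance at most (k + 1) / 2 from the center, write
     PI (d k m - d k (m - 1)) =
       2^(k+1) \int_0^PI (\prod_(i <= k) cos (i x / 2)) sin (t x) sin (x / 2) dx
   with t = k (k + 1) / 4 - m + 1/2.  The part of the integral near 0 is of order
   t k^(-9/2), and away from 0 the product is at most exp (- k / 5) by the
   closed form of the Dirichlet kernel, so the integral is positive for
   k >= 120.  The cases k <= 120 are computed. *)
From Stdlib Require Import NArith Reals Lra Lia.
From Coquelicot Require Import Coquelicot.
Require Import Defs.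
From mathcomp Require Import all_boot zify_ssreflect.

Local Open Scope R_scope.

(** * Elementary bounds for sine and cosine *)

Lemma sin_ge_cubic x : 0 <= x <= 4 -> x - x ^ 3 / 6 <= sin x.
Proof.
intros [x0 x4].
destruct (pre_sin_bound x 0 x0 x4) as [H _].
unfold sin_approx, sin_term in H; simpl in H; simpl; lra.
Qed.

Lemma sin_ge_linear x : 0 <= x <= 0.2 -> 0.99 * x <= sin x.
Proof.
intros Hx; assert (S := sin_ge_cubic x ltac:(lra)).
assert (x * x <= 0.04) by nra.
assert (x * (x * x) <= x * 0.04) by (apply Rmult_le_compat_l; lra).
simpl in S; lra.
Qed.

Lemma cos_ge_quadratic x : 1 - x ^ 2 / 2 <= cos x.
Proof.
assert (sin_sqr : forall y, 0 <= y -> sin y ^ 2 <= y ^ 2).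
  intros y y0; apply pow_maj_Rabs, Rabs_le.
  destruct (Req_dec y 0) as [-> | yn]; [rewrite sin_0; lra|].
  pose proof (sin_lt_x y ltac:(lra)); split; [|lra].
  destruct (Rle_dec y PI) as [yPI | yPI].
    pose proof (sin_ge_0 y y0 yPI); lra.
  pose proof (SIN_bound y); pose proof PI2_3_2; lra.
assert (H : sin (x / 2) ^ 2 <= (x / 2) ^ 2).
  destruct (Rle_dec 0 x) as [x0 | x0]; [apply sin_sqr; lra|].
  replace (x / 2) with (- (- x / 2)) by field; rewrite sin_neg.
  pose proof (sin_sqr (- x / 2) ltac:(lra)); nra.
replace x with (2 * (x / 2)) at 2 by field.
rewrite cos_2a_sin; nra.
Qed.

(** * The cosine product near 0 and away from 0 *)

(** Times [2 ^ k], this is the generating polynomial at e^(ix) divided by the phase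
    e^(ik(k+1)x/4). *)
Fixpoint cos_prod (k : nat) (x : R) : R :=
  match k with
  | O => 1
  | S k' => cos_prod k' x * cos (INR (S k') * x / 2)
  end.

Lemma continuous_cos_lin a x : continuous (fun y => cos (a * y)) x.
Proof. apply (ex_derive_continuous (fun y => cos (a * y))); now auto_derive. Qed.

Lemma continuous_sin_lin a x : continuous (fun y => sin (a * y)) x.
Proof. apply (ex_derive_continuous (fun y => sin (a * y))); now auto_derive. Qed.

Lemma continuous_cos_prod k x : continuous (cos_prod k) x.
Proof.
induction k as [|k IH]; [apply continuous_const|].
apply (continuous_mult (cos_prod k)); [exact IH|].
apply continuous_ext with (f := fun y => cos (INR (S k) / 2 * y)).
  intros y; f_equal; field.
apply continuous_cos_lin.
Qed.

Lemma cos_prod_bounds k x : 0 <= x -> INR k * x <= PI -> 0 <= cos_prod k x <= 1.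
Proof.
intros x0; induction k as [|k IH]; [simpl; lra|]; intros kx.
assert (k0 := pos_INR k).
change (cos_prod (S k) x) with (cos_prod k x * cos (INR (S k) * x / 2)).
rewrite S_INR; rewrite S_INR in kx.
assert (H := IH ltac:(nra)).
assert (C := COS_bound ((INR k + 1) * x / 2)).
assert (P := PI_RGT_0).
assert (0 <= cos ((INR k + 1) * x / 2)) by (apply cos_ge_0; nra).
nra.
Qed.

(** All factors lie in [0, 1], so the product is at least 1 minus the sum of the defects
    [1 - cos (j x / 2) <= j^2 x^2 / 8]; the cubic in [k] is the sum of the squares [j^2]. *)
Lemma cos_prod_ge k x : 0 <= x -> INR k * x <= PI ->
  1 - x ^ 2 * (INR k * (INR k + 1) * (2 * INR k + 1)) / 48 <= cos_prod k x.
Proof.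
intros x0; induction k as [|k IH]; [simpl; lra|]; intros kx.
assert (k0 := pos_INR k).
change (cos_prod (S k) x) with (cos_prod k x * cos (INR (S k) * x / 2)).
rewrite S_INR; rewrite S_INR in kx.
assert (kx' : INR k * x <= PI) by nra.
assert (H := IH kx').
assert (B := cos_prod_bounds k x x0 kx').
assert (C := COS_bound ((INR k + 1) * x / 2)).
assert (Q := cos_ge_quadratic ((INR k + 1) * x / 2)).
set (c := cos _) in *; set (p := cos_prod k x) in *.
assert (p * (1 - c) <= 1 - c) by nra.
assert (p * c >= p - (1 - c)) by lra.
nra.
Qed.

Fixpoint cos_sum (k : nat) (x : R) : R :=
  match k with
  | O => 0
  | S k' => cos_sum k' x + cos (INR (S k') * x)
  end.

Lemma dirichlet_kernel k x :
  2 * sin (x / 2) * cos_sum k x = sin ((INR k + / 2) * x) - sin (x / 2).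
Proof.
induction k as [|k IH].
  simpl; replace ((0 + / 2) * x) with (x / 2) by field; ring.
change (cos_sum (S k) x) with (cos_sum k x + cos (INR (S k) * x)).
rewrite Rmult_plus_distr_l IH S_INR.
replace ((INR k + / 2) * x) with ((INR k + 1) * x - x / 2) by field.
replace ((INR k + 1 + / 2) * x) with ((INR k + 1) * x + x / 2) by field.
rewrite sin_plus sin_minus; ring.
Qed.

(* cos^2 (y / 2) = 1 - (1 - cos y) / 2 <= exp (- (1 - cos y) / 2), factor by factor. *)
Lemma cos_prod_sqr_le k x :
  cos_prod k x ^ 2 <= exp (- (INR k - cos_sum k x) / 2).
Proof.
induction k as [|k IH].
  simpl; replace (- (0 - 0) / 2) with 0 by field; rewrite exp_0; lra.
change (cos_prod (S k) x) with (cos_prod k x * cos (INR (S k) * x / 2)).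
change (cos_sum (S k) x) with (cos_sum k x + cos (INR (S k) * x)).
rewrite Rpow_mult_distr.
set (y := INR (S k) * x).
replace (- (INR (S k) - (cos_sum k x + cos y)) / 2) with
  (- (INR k - cos_sum k x) / 2 + - (1 - cos y) / 2) by (rewrite S_INR; field).
rewrite exp_plus; apply Rmult_le_compat; [apply pow2_ge_0|apply pow2_ge_0|exact IH|].
assert (E := exp_ineq1_le (- (1 - cos y) / 2)).
assert (C : cos y = 2 * cos (y / 2) * cos (y / 2) - 1).
  rewrite <- cos_2a_cos; f_equal; field.
simpl; lra.
Qed.

(** By [cos_prod_sqr_le] it suffices that [cos_sum k x <= k / 5]: the squared product is then at
    most [exp (- 2 k / 5)]. *)
Lemma cos_prod_tail k x : 100 <= INR k -> PI / (INR k + / 2) <= x <= PI ->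
  Rabs (cos_prod k x) <= exp (- INR k / 5).
Proof.
intros k100 [xl xr].
assert (P4 := PI_4); assert (P3 := PI2_3_2).
set (x0 := PI / (INR k + / 2)) in *.
assert (x0E : x0 * (INR k + / 2) = PI) by (unfold x0; field; lra).
assert (x0p : 0 < x0) by nra.
assert (x0s : x0 <= 4 / 100) by nra.
assert (S : cos_sum k x <= INR k / 5).
  assert (D := dirichlet_kernel k x).
  (* Up to [2 * x0] the angle [(k + 1/2) x] stays in [PI, 2 PI]; beyond, [x / 2 >= x0] and sine
     increases up to PI / 2. *)
  assert (S0 : sin x0 <= sin (x / 2) \/ sin ((INR k + / 2) * x) <= 0).
    destruct (Rle_dec x (2 * x0)).
      right; apply sin_le_0; nra.
    left; apply sin_incr_1; lra.
  assert (sx : 0 < sin (x / 2)) by (apply sin_gt_0; lra).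
  destruct S0 as [S0 | S0]; [|nra].
  assert (C := sin_ge_linear x0 ltac:(lra)).
  (* [0.99 * x0 * (k + 1/2) = 0.99 * PI > 2.7], whence [cos_sum k x <= (k + 1/2) / 5.4 - 1/2]. *)
  assert (sin (x / 2) * (INR k + / 2) >= 2.7) by nra.
  assert (B := SIN_bound ((INR k + / 2) * x)).
  apply (Rmult_le_reg_l (2 * sin (x / 2))); [lra|].
  rewrite D; nra.
rewrite <- (Rabs_pos_eq (exp _)) by (left; apply exp_pos).
apply Rsqr_le_abs_0; unfold Rsqr.
rewrite <- exp_plus.
apply Rle_trans with (cos_prod k x ^ 2); [simpl; lra|].
apply Rle_trans with (1 := cos_prod_sqr_le k x).
destruct (Req_dec (- (INR k - cos_sum k x) / 2) (- INR k / 5 + - INR k / 5)) as [-> | ne]; [lra|].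
left; apply exp_increasing; lra.
Qed.

(** Fifth power of [0.874 k <= exp (k / 25)], as [0.874^5 > 1/2]. The linear bound comes from
    [exp 4.8 >= 110] and [1 + y <= exp y], where 4.8 = 120 / 25. *)
Lemma exp_gt_quintic k : 120 <= k -> k ^ 5 / 2 <= exp (k / 5).
Proof.
intros k120.
assert (dbl : forall x a b, 0 <= a -> a <= exp x -> b <= a * a -> b <= exp (2 * x)).
  intros x a b a0 ax ba; replace (2 * x) with (x + x) by ring.
  rewrite exp_plus; nra.
assert (E : 110 <= exp 4.8).
  (* 0.01875 = 4.8 / 256: eight doublings of the argument lead to 4.8. *)
  assert (H := exp_ineq1_le 0.01875).
  apply (dbl _ _ 1.0378) in H; [|lra|lra].
  apply (dbl _ _ 1.0770) in H; [|lra|lra].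
  apply (dbl _ _ 1.1599) in H; [|lra|lra].
  apply (dbl _ _ 1.3453) in H; [|lra|lra].
  apply (dbl _ _ 1.8098) in H; [|lra|lra].
  apply (dbl _ _ 3.275) in H; [|lra|lra].
  apply (dbl _ _ 10.72) in H; [|lra|lra].
  apply (dbl _ _ 110) in H; [|lra|lra].
  eapply Rle_trans; [exact H|right; f_equal; lra].
assert (E25 : 0.874 * k <= exp (k / 25)).
  replace (k / 25) with (4.8 + (k / 25 - 4.8)) by ring.
  rewrite exp_plus.
  assert (H := exp_ineq1_le (k / 25 - 4.8)).
  assert (110 * (1 + (k / 25 - 4.8)) <= exp 4.8 * exp (k / 25 - 4.8)).
    apply Rmult_le_compat; lra.
  lra.
replace (k / 5) with (k / 25 + k / 25 + k / 25 + k / 25 + k / 25) by field.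
rewrite !exp_plus.
apply Rle_trans with ((0.874 * k) ^ 5).
  rewrite Rpow_mult_distr.
  assert (0 <= k ^ 5) by (apply pow_le; lra).
  assert (/ 2 <= 0.874 ^ 5) by lra.
  nra.
apply Rle_trans with (exp (k / 25) ^ 5); [apply pow_incr; lra|simpl; lra].
Qed.

(** * Positivity of the integral *)

Lemma continuous_integrand k t x :
  continuous (fun y => cos_prod k y * (sin (t * y) * sin (/ 2 * y))) x.
Proof.
apply (continuous_mult (cos_prod k)); [apply continuous_cos_prod|].
apply (continuous_mult (fun y => sin (t * y))); apply continuous_sin_lin.
Qed.

Lemma ex_RInt_integrand k t a b :
  ex_RInt (fun y => cos_prod k y * (sin (t * y) * sin (/ 2 * y))) a b.
Proof.
apply (ex_RInt_continuous (V := R_CompleteNormedModule)); intros x _.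
apply continuous_integrand.
Qed.

Lemma is_RInt_scal_sqr b c : is_RInt (fun x => b * x ^ 2) 0 c (b * c ^ 3 / 3).
Proof.
replace (b * c ^ 3 / 3) with (minus (b * c ^ 3 / 3) (b * 0 ^ 3 / 3))
  by (unfold minus, plus, opp; simpl; field).
apply (is_RInt_derive (fun x => b * x ^ 3 / 3)); intros x _.
  auto_derive; [trivial|simpl; field].
apply (ex_derive_continuous (fun x => b * x ^ 2)); now auto_derive.
Qed.

Lemma integrand_RInt_pos k t : 120 <= INR k -> 0 < t <= (INR k + 1) / 2 ->
  0 < RInt (fun x => cos_prod k x * (sin (t * x) * sin (/ 2 * x))) 0 PI.
Proof.
intros k120 [t0 tk].
assert (P4 := PI_4); assert (P3 := PI2_3_2).
set (K := INR k) in *; set (s := sqrt K).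
assert (s2 : s * s = K) by (apply sqrt_sqrt; lra).
assert (s0 : 0 <= s) by apply sqrt_pos.
assert (s10 : 10.9 <= s) by nra.
(* On [0, c] the product is at least 1/2; from [x1], the first zero of the
   Dirichlet kernel's numerator, it is exponentially small; on [c, x1] the
   integrand is nonnegative. *)
set (c := 3.4 / (K * s)); set (x1 := PI / (K + / 2)).
assert (Ks : 0 < K * s) by nra.
assert (cE : c * (K * s) = 3.4) by (unfold c; field; lra).
assert (x1E : x1 * (K + / 2) = PI) by (unfold x1; field; lra).
assert (c0 : 0 < c) by (unfold c; apply Rdiv_lt_0_compat; lra).
assert (x10 : 0 < x1) by nra.
assert (cK : c * K <= 0.32) by nra.
assert (cx : c <= x1) by nra.
assert (x1PI : x1 <= PI) by nra.
rewrite <- (RInt_Chasles _ 0 x1 PI) by apply ex_RInt_integrand.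
rewrite <- (RInt_Chasles _ 0 c x1) by apply ex_RInt_integrand.
unfold plus; simpl.
set (I1 := RInt _ 0 c); set (I2 := RInt _ c x1); set (I3 := RInt _ x1 PI).
(* The integrand is at least [1/2 * (0.99 t x) * (0.99 x / 2) >= 0.24 t x^2], and 0.08 = 0.24 /
   3. *)
assert (H1 : 0.08 * t * c ^ 3 <= I1).
  assert (Q := is_RInt_scal_sqr (0.24 * t) c).
  replace (0.08 * t * c ^ 3) with (0.24 * t * c ^ 3 / 3) by lra.
  rewrite <- (is_RInt_unique _ _ _ _ Q).
  apply RInt_le; [lra|eexists; exact Q|apply ex_RInt_integrand|].
  intros x [xl xr]; simpl.
  (* By the choice of [c], [c^2 K^3 = 11.56], and [11.56 * 2.05 / 48 < 1/2]; 2.05 absorbs the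
     lower-order terms of [(K + 1) (2 K + 1)]. *)
  assert (F : / 2 <= cos_prod k x).
    eapply Rle_trans; [|apply cos_prod_ge; [lra|fold K; nra]].
    fold K.
    assert (x * x <= c * c) by nra.
    assert (cc : c * c * (K * K * K) = 11.56).
      transitivity ((c * (K * s)) * (c * (K * s))); [rewrite <- s2 at 3; ring|rewrite cE; lra].
    assert ((K + 1) * (2 * K + 1) <= 2.05 * (K * K)) by nra.
    assert (c * c * (K * ((K + 1) * (2 * K + 1))) <= 2.05 * (c * c * (K * K * K))).
      replace (2.05 * (c * c * (K * K * K))) with (c * c * (K * (2.05 * (K * K)))) by ring.
      apply Rmult_le_compat_l; [nra|apply Rmult_le_compat_l; lra].
    assert (x * x * (K * ((K + 1) * (2 * K + 1))) <= c * c * (K * ((K + 1) * (2 * K + 1)))).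
      apply Rmult_le_compat_r; [|lra].
      apply Rmult_le_pos; nra.
    simpl; lra.
  assert (A : 0.99 * (t * x) <= sin (t * x)).
    assert (tx : 0 < t * x <= 0.17).
      split; [nra|].
      apply Rle_trans with ((K + 1) / 2 * c); [apply Rmult_le_compat; lra|].
      nra.
    apply sin_ge_linear; lra.
  assert (B : 0.99 * (/ 2 * x) <= sin (/ 2 * x)).
    assert (c <= 0.01) by nra.
    apply sin_ge_linear; lra.
  assert (tx : 0 < t * x) by nra.
  assert (AB : 0.99 * (t * x) * (0.99 * (/ 2 * x)) <= sin (t * x) * sin (/ 2 * x)).
    apply Rmult_le_compat; lra.
  assert (/ 2 * (0.99 * (t * x) * (0.99 * (/ 2 * x))) <=
      cos_prod k x * (sin (t * x) * sin (/ 2 * x))).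
    apply Rmult_le_compat; [lra| |lra|lra].
    apply Rmult_le_pos; lra.
  assert (0 <= t * x * x) by nra.
  lra.
assert (H2 : 0 <= I2).
  apply RInt_ge_0; [lra|apply ex_RInt_integrand|].
  intros x [xl xr].
  apply Rmult_le_pos; [apply cos_prod_bounds; [lra|fold K; nra]|].
  apply Rmult_le_pos; apply sin_ge_0; nra.
(* Bounding [sin (t x)] by [t PI] keeps the factor [t], to match the lower bound for [I1], which is
   proportional to [t]. *)
assert (H3 : Rabs I3 <= (PI - x1) * (exp (- K / 5) * (t * PI))).
  apply abs_RInt_le_const; [lra|apply ex_RInt_integrand|].
  intros x [xl xr]; rewrite !Rabs_mult.
  apply Rmult_le_compat; [apply Rabs_pos| |apply cos_prod_tail; [fold K; lra|split; [exact xl|lra]]|].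
    apply Rmult_le_pos; apply Rabs_pos.
  replace (t * PI) with (t * PI * 1) by ring.
  apply Rmult_le_compat; [apply Rabs_pos|apply Rabs_pos| |].
    assert (0 < t * x) by nra.
    assert (t * x <= t * PI) by nra.
    assert (S := sin_lt_x (t * x) ltac:(lra)).
    assert (B := SIN_bound (t * x)).
    apply Rabs_le; split; [|lra].
    destruct (Rle_dec (t * x) PI) as [y | y]; [|lra].
    assert (Z := sin_ge_0 (t * x) ltac:(lra) y); lra.
  apply Rabs_le; apply SIN_bound.
assert (E := exp_gt_quintic K k120).
assert (EV : exp (- K / 5) * exp (K / 5) = 1).
  rewrite <- exp_plus; replace (- K / 5 + K / 5) with 0 by field; apply exp_0.
set (e := exp (- K / 5)) in *; set (g := exp (K / 5)) in *.
assert (e0 : 0 < e) by apply exp_pos.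
(* 39.304 = 3.4^3. With [K^4 s <= K^5 / 10.9 <= 0.1836 g] this yields [c^3 >= 214 e], and
   [0.08 * 214 > 16 >= PI^2] decides the comparison of [I1] with [I3]. *)
assert (c3 : c ^ 3 * (K ^ 4 * s) = 39.304).
  transitivity ((c * (K * s)) ^ 3); [rewrite <- s2; ring|rewrite cE; lra].
assert (c30 : 0 < c ^ 3) by (apply pow_lt; lra).
assert (sK : s <= K / 10.9) by nra.
assert (K40 : 0 < K ^ 4) by (apply pow_lt; lra).
assert (gK : K ^ 4 * s <= 0.1836 * g).
  apply Rle_trans with (K ^ 4 * (K / 10.9)); [apply Rmult_le_compat_l; lra|].
  replace (K ^ 4 * (K / 10.9)) with (K ^ 5 / 10.9) by (unfold Rdiv; ring).
  assert (0 < K ^ 5) by (apply pow_lt; lra); lra.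
assert (c3g : 214 <= c ^ 3 * g) by nra.
assert (c3e : 214 * e <= c ^ 3).
  replace (c ^ 3) with (c ^ 3 * g * e) by (rewrite Rmult_assoc (Rmult_comm g) EV; ring).
  apply Rmult_le_compat_r; lra.
assert (T : (PI - x1) * (e * (t * PI)) <= 16 * (e * t)).
  assert (0 < e * t) by nra.
  replace ((PI - x1) * (e * (t * PI))) with ((PI - x1) * PI * (e * t)) by ring.
  apply Rmult_le_compat_r; [lra|nra].
assert (A := Rcomplements.Rabs_le_between I3 ((PI - x1) * (e * (t * PI)))).
assert (L : - ((PI - x1) * (e * (t * PI))) <= I3) by (apply A; exact H3).
assert (214 * e * t <= c ^ 3 * t) by (apply Rmult_le_compat_r; lra).
assert (0 < e * t) by nra.
lra.
Qed.

Local Close Scope R_scope.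
Set Implicit Arguments.
Unset Strict Implicit.
Unset Printing Implicit Defensive.
Local Open Scope nat_scope.

(** * Recurrence in [k] and computed coefficients *)

Lemma d_0 m : d 0 m = (m == 0).
Proof.
have sum0 (A : {set 'I_1}) : ord0 \notin A -> A = set0.
  by move=> A0; apply/setP=> i; rewrite inE ord1 (negbTE A0).
case: eqP => [->|/eqP m0] /=.
  apply: (@eq_card1 _ set0) => A; rewrite !inE.
  apply/andP/eqP => [[/sum0]|->] //.
  by rewrite inE big_set0.
apply: eq_card0 => A; rewrite !inE; apply/negP => /andP[/sum0 ->].
by rewrite big_set0 eq_sym (negbTE m0).
Qed.

(** The sets are split by whether they contain the part [k.+1], which is [ord_max]; [lift ord_max]
    embeds the smaller index type without changing values. Without the test [k.+1 <= m], truncated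
    subtraction would contribute [d k 0 = 1]. *)
Lemma d_recl k m :
  d k.+1 m = d k m + (if k.+1 <= m then d k (m - k.+1) else 0).
Proof.
pose f : 'I_k.+1 -> 'I_k.+2 := lift ord_max.
have finj : injective f := @lift_inj _ _.
have max_f (B : {set 'I_k.+1}) : ord_max \notin f @: B.
  by apply/imsetP => -[i _ /eqP]; rewrite (negbTE (neq_lift _ _)).
have f0 : f ord0 = ord0 by apply/val_inj; rewrite /= /bump leqn0.
have sumf (B : {set 'I_k.+1}) : \sum_(i in f @: B) i = \sum_(i in B) i.
  by rewrite big_imset /=; [apply: eq_bigr => i _; exact: lift_max|move=> ? ? _ _ /finj].
have mem0 (B : {set 'I_k.+1}) : (ord0 \in f @: B) = (ord0 \in B).
  by rewrite -f0 mem_imset.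
have fK (A : {set 'I_k.+2}) : f @: (f @^-1: A) = A :\ ord_max.
  apply/setP => i; rewrite !inE; case: (unliftP ord_max i) => [j ->|->].
    by rewrite mem_imset // inE eq_sym neq_lift.
  by rewrite eqxx (negbTE (max_f _)).
have imK (A B : {set 'I_k.+1}) : f @: A = f @: B -> A = B.
  by move=> /imset_inj; apply.
rewrite /d -(cardsID [set A : {set 'I_k.+2} | ord_max \in A]) addnC; congr (_ + _).
  rewrite -(card_imset _ (imset_inj finj)); congr #|pred_of_set _|; apply/setP=> A.
  rewrite !inE; apply/and3P/imsetP => [[Am A0 As]|[B]].
    have e : f @: (f @^-1: A) = A.
      by rewrite fK setDE; apply/setIidPl; rewrite subsetC sub1set inE.
    exists (f @^-1: A); last by rewrite e.
    by rewrite in_set -mem0 -sumf e A0.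
  by rewrite in_set => /andP[B0 Bs] ->; rewrite max_f mem0 sumf.
have sumU (B : {set 'I_k.+1}) :
    \sum_(i in ord_max |: f @: B) i = k.+1 + \sum_(i in B) i.
  by rewrite big_setU1 ?max_f //= sumf.
have mem0U (B : {set 'I_k.+1}) : (ord0 \in ord_max |: f @: B) = (ord0 \in B).
  by rewrite !inE mem0.
have decomp (A : {set 'I_k.+2}) : ord_max \in A -> A = ord_max |: f @: (f @^-1: A).
  by move=> Am; rewrite fK setD1K.
case: leqP => km.
  apply: eq_card0 => A; rewrite !inE; apply/negP => /andP[/andP[_ /eqP As] /decomp e].
  by move: As km; rewrite e sumU => <-; rewrite ltnNge leq_addr.
have injU : injective (fun B : {set 'I_k.+1} => ord_max |: f @: B).
  by move=> B C /(congr1 (fun D => D :\ ord_max)); rewrite !setU1K ?max_f // => /imK.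
rewrite -(card_imset _ injU); congr #|pred_of_set _|; apply/setP=> A.
rewrite !inE; apply/andP/imsetP => [[/andP[A0 /eqP As] /decomp e]|[B]].
  exists (f @^-1: A) => //.
  by rewrite in_set -mem0U -e A0 -As [in X in _ == X - _]e sumU addKn /=.
rewrite in_set => /andP[B0 /eqP Bs] ->.
by rewrite mem0U B0 sumU Bs subnKC // !inE !eqxx.
Qed.

Fixpoint coef_add (p q : seq N) : seq N :=
  match p, q with
  | [::], _ => q
  | _, [::] => p
  | a :: p', b :: q' => N.add a b :: coef_add p' q'
  end.

(** Multiplication by [1 + x^(k+1)], on coefficient lists with lowest degree first. *)
Definition coef_next (k : nat) (p : seq N) : seq N :=
  coef_add p (ncons k.+1 0%num p).

Fixpoint coefs (k : nat) : seq N :=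
  if k is k'.+1 then coef_next k' (coefs k') else [:: 1%num].

Lemma nth_coef_add p q m :
  nth 0%num (coef_add p q) m = N.add (nth 0%num p m) (nth 0%num q m).
Proof.
by elim: p q m => [|a p IH] [|b q] [|m] //=; rewrite ?N.add_0_r.
Qed.

Lemma nth_coefs k m : nth 0%num (coefs k) m = N.of_nat (d k m).
Proof.
elim: k m => [|k IH] m; first by rewrite d_0; case: m => [|[|m]].
rewrite [coefs _]/= /coef_next nth_coef_add nth_ncons !IH d_recl Nnat.Nat2N.inj_add.
by case: leqP.
Qed.

Lemma d_coefs k m : d k m = N.to_nat (nth 0%num (coefs k) m).
Proof. by rewrite nth_coefs Nnat.Nat2N.id. Qed.

(** The first comparison is between indices 4 and 5, past the equality at [m = 4]. *)
Definition increasing_to_middle (k : nat) (p : seq N) : bool :=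
  sorted N.ltb (drop 4 (take (k * k.+1 %/ 4).+1 p)).

(** Each row is obtained from the previous one; 109 rows starting at 12 end at 120. *)
Fixpoint check_increasing (n k : nat) (p : seq N) : bool :=
  if n is n'.+1 then
    increasing_to_middle k p && check_increasing n' k.+1 (coef_next k p)
  else true.

Lemma check_increasing_12_120 : check_increasing 109 12 (coefs 12).
Proof. by vm_compute. Qed.

(** * Integral representation, symmetry, and growth near the center *)

Local Open Scope R_scope.

(* Up to the factor [2 ^ k / PI] this is the coefficient of
   \prod_i (x ^ (i / 2) + x ^ (- i / 2)) at exponents [a] in [center k + Z]. *)
Definition fourier (k : nat) (a : R) : R :=
  RInt (fun x => cos_prod k x * cos (a * x)) 0 PI.

Lemma is_RInt_fourier k a :
  is_RInt (fun x => cos_prod k x * cos (a * x)) 0 PI (fourier k a).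
Proof.
apply (RInt_correct (V := R_CompleteNormedModule)).
apply (ex_RInt_continuous (V := R_CompleteNormedModule)); intros x _.
apply (continuous_mult (cos_prod k)).
  apply continuous_cos_prod.
apply continuous_cos_lin.
Qed.

Lemma fourier_opp k a : fourier k (- a) = fourier k a.
Proof.
apply RInt_ext; intros x _.
now rewrite Ropp_mult_distr_l_reverse cos_neg.
Qed.

(** Product-to-sum formula applied to [cos (a x)] and the last factor of the product. *)
Lemma fourier_S k a :
  2 * fourier (S k) a = fourier k (a + INR (S k) / 2) + fourier k (a - INR (S k) / 2).
Proof.
assert (H := is_RInt_plus _ _ _ _ _ _
  (@is_RInt_fourier k (a + INR (S k) / 2)) (@is_RInt_fourier k (a - INR (S k) / 2))).
assert (G := is_RInt_scal _ _ _ 2 _ (@is_RInt_fourier (S k) a)).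
transitivity (RInt (fun x => 2 * (cos_prod (S k) x * cos (a * x))) 0 PI).
  symmetry; apply is_RInt_unique; exact G.
apply is_RInt_unique.
refine (is_RInt_ext _ _ _ _ _ _ H); intros x _.
change (cos_prod (S k) x) with (cos_prod k x * cos (INR (S k) * x / 2)).
set (y := INR (S k)); unfold plus; simpl.
replace ((a + y / 2) * x) with (a * x + y * x / 2) by field.
replace ((a - y / 2) * x) with (a * x - y * x / 2) by field.
rewrite cos_plus cos_minus; ring.
Qed.

Lemma fourier_0_0 : fourier 0 0 = PI.
Proof.
unfold fourier; rewrite (RInt_ext _ (fun _ => 1)).
  rewrite RInt_const; unfold scal; simpl; unfold mult; simpl; ring.
intros x _; simpl; rewrite Rmult_0_l cos_0; ring.
Qed.

Lemma fourier_0_S j : fourier 0 (INR (S j)) = 0.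
Proof.
set (a := INR (S j)).
assert (a0 : a <> 0) by (apply not_0_INR; discriminate).
apply is_RInt_unique.
replace 0 with (minus (sin (a * PI) / a) (sin (a * 0) / a)) at 2.
  apply (is_RInt_derive (fun x => sin (a * x) / a)); intros x _.
    auto_derive; [trivial|simpl; field; exact a0].
  apply (ex_derive_continuous (fun x => 1 * cos (a * x))); now auto_derive.
rewrite Rmult_0_r sin_0 (sin_eq_0_1 (a * PI)).
  unfold minus, plus, opp; simpl; field; exact a0.
exists (Z.of_nat (S j)); unfold a; now rewrite INR_IZR_INZ.
Qed.

(* Half of [max_weight k], which need not be an integer. *)
Definition center (k : nat) : R := INR k * (INR k + 1) / 4.

Lemma center_S k : center (S k) = center k + INR (S k) / 2.
Proof. unfold center; rewrite S_INR; field. Qed.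

(** [center k] is the top exponent of the recentred polynomial. This supplies the zero branch of
    [d_recl] in [fourier_d]. *)
Lemma fourier_beyond k j : fourier k (center k + INR (S j)) = 0.
Proof.
revert j; induction k as [|k IH]; intros j.
  replace (center 0 + INR (S j)) with (INR (S j)) by (unfold center; simpl INR; field).
  apply fourier_0_S.
apply (Rmult_eq_reg_l 2); [|lra].
rewrite fourier_S center_S Rmult_0_r.
replace (center k + INR (S k) / 2 + INR (S j) + INR (S k) / 2)
  with (center k + INR (S (S k + j))) by (rewrite !S_INR plus_INR ?S_INR; field).
replace (center k + INR (S k) / 2 + INR (S j) - INR (S k) / 2)
  with (center k + INR (S j)) by field.
rewrite !IH; ring.
Qed.

(** Both sides obey the same recurrence: [fourier_S] on the left, [d_recl] on the right. *)
Lemma fourier_d k m : 2 ^ k * fourier k (center k - INR m) = PI * INR (d k m).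
Proof.
revert m; induction k as [|k IH]; intros m.
  replace (center 0 - INR m) with (- INR m) by (unfold center; simpl INR; field).
  rewrite fourier_opp d_0; destruct m as [|m].
    simpl; rewrite fourier_0_0; ring.
  rewrite fourier_0_S; simpl; ring.
replace (2 ^ S k * _) with (2 ^ k * (2 * fourier (S k) (center (S k) - INR m)))
  by (simpl; ring).
rewrite fourier_S center_S Rmult_plus_distr_l.
replace (center k + INR (S k) / 2 - INR m - INR (S k) / 2)
  with (center k - INR m) by field.
rewrite d_recl plus_INR Rmult_plus_distr_l IH Rplus_comm; f_equal.
case: leqP => /leP km; last first.
  rewrite -IH (minus_INR _ _ km); do 2 f_equal; field.
(* For [m <= k] the shifted exponent exceeds [center k] by [k + 1 - m >= 1]. *)
replace (center k + INR (S k) / 2 - INR m + INR (S k) / 2)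
  with (center k + INR (S (k - m))).
  rewrite fourier_beyond; simpl; ring.
rewrite -subSn; last by apply/leP.
rewrite minus_INR; [field|lia].
Qed.

Lemma double_max_weight k : (max_weight k).*2 = (k * k.+1)%N.
Proof. by rewrite /max_weight halfK oddM oddS andbN subn0. Qed.

(** [fourier k] is even, and the reflection of [m] negates [center k - m]. *)
Lemma d_symmetric k m : (m <= max_weight k)%N -> d k m = d k (max_weight k - m).
Proof.
move=> /leP mN; apply: INR_eq.
apply: (Rmult_eq_reg_l PI); last by have := PI_RGT_0; lra.
rewrite -!fourier_d minus_INR // -[in RHS]fourier_opp; do 2 f_equal.
have -> : INR (max_weight k) = 2 * center k; last by lra.
have := f_equal INR (double_max_weight k).
rewrite -addnn plus_INR mult_INR S_INR /center; lra.
Qed.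

(** The two exponents are [t - 1/2] and [t + 1/2], so the difference of the cosines is
    [2 sin (t x) sin (x / 2)], the integrand of [integrand_RInt_pos]. *)
Lemma d_increasing_near_center k m : (120 <= k)%N ->
  0 < center k - INR m - / 2 <= (INR k + 1) / 2 -> (d k m < d k m.+1)%N.
Proof.
move=> /leP k120 ht; apply/ltP/INR_lt.
have {k120} K : 120 <= INR k by have := le_INR _ _ k120; rewrite (INR_IZR_INZ 120).
have W := integrand_RInt_pos _ _ K ht; set t := center k - _ - _ in W.
have D := is_RInt_minus _ _ _ _ _ _
  (@is_RInt_fourier k (center k - INR m.+1)) (@is_RInt_fourier k (center k - INR m)).
have E : fourier k (center k - INR m.+1) - fourier k (center k - INR m) =
    RInt (fun x => 2 * (cos_prod k x * (sin (t * x) * sin (/ 2 * x)))) 0 PI.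
  symmetry; apply: is_RInt_unique; apply: is_RInt_ext D => x _.
  have -> : (center k - INR m.+1) * x = t * x - / 2 * x by rewrite S_INR /t; field.
  have -> : (center k - INR m) * x = t * x + / 2 * x by rewrite /t; field.
  rewrite cos_plus cos_minus /minus /plus /opp /=; ring.
rewrite (RInt_scal (V := R_CompleteNormedModule)) in E; last exact: ex_RInt_integrand.
rewrite -[scal _ _]/(2 * RInt (fun x => cos_prod k x * (sin (t * x) * sin (/ 2 * x))) 0 PI) in E.
have := fourier_d k m; have := fourier_d k m.+1.
have P := PI_RGT_0; have Q : 0 < 2 ^ k by apply: pow_lt; lra.
move=> e1 e2; apply: (Rmult_lt_reg_l PI) => //; rewrite -e1 -e2.
apply: Rmult_lt_compat_l => //. lra.
Qed.

Local Close Scope R_scope.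

(** * Strict growth up to the middle *)

Lemma d_stable k m : m <= k -> d k m = d m m.
Proof.
move=> /subnK <-; elim: (k - m) => // n IH.
by rewrite addSn d_recl ltnNge leq_addl addn0.
Qed.

Lemma d_small k : [/\ d k 0 = 1, 1 <= k -> d k 1 = 1, 2 <= k -> d k 2 = 1,
  3 <= k -> d k 3 = 2 & 4 <= k -> d k 4 = 2].
Proof.
by split=> [|/d_stable->|/d_stable->|/d_stable->|/d_stable->];
  rewrite ?(d_stable (leq0n k)) d_coefs.
Qed.

Lemma size_coefs k : (size (coefs k)).*2 = (k * k.+1).+2.
Proof.
have size_add p q : size (coef_add p q) = maxn (size p) (size q).
  by elim: p q => [|a p IH] [|b q] //=; rewrite ?max0n ?maxn0 // IH maxnSS.
elim: k => // k IH; rewrite [coefs _]/= /coef_next size_add size_ncons.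
rewrite (maxn_idPr (leq_addl _ _)) doubleD IH.
by rewrite !addnS -mul2n -mulnDl add2n mulnC.
Qed.

Lemma d_increasing_check k : 12 <= k <= 120 ->
  forall m, 5 <= m -> 4 * m <= k * k.+1 -> d k m.-1 < d k m.
Proof.
have main n j : check_increasing n j (coefs j) ->
    forall i, j <= i < j + n -> increasing_to_middle i (coefs i).
  elim: n j => [|n IH] j /=.
    by move=> _ i; rewrite addn0 ltnNge andbN.
  case/andP=> h0 /(IH j.+1) h1 i; case: (eqVneq j i) => [<- //|ji iP].
  by apply: h1; lia.
move=> kb m m5 mk.
have /(_ k kb) := main _ _ check_increasing_12_120.
have mid : m < (k * k.+1 %/ 4).+1 by rewrite ltnS leq_divRL // mulnC.
have size_mid : m < size (coefs k).
  by rewrite -ltn_double size_coefs ltnS -addnn; lia.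
have nth_mid i : i <= m -> nth 0%num (take (k * k.+1 %/ 4).+1 (coefs k)) i = N.of_nat (d k i).
  by move=> im; rewrite nth_take ?nth_coefs // (leq_ltn_trans im).
move=> /(sortedP 0%num)/(_ (m - 5)); rewrite size_drop size_take_min !nth_drop.
(* After [drop 4], positions [m - 5] and [m - 4] hold the coefficients of index [m - 1] and [m]. *)
have -> : 4 + (m - 5) = m.-1 by lia.
have -> : 4 + (m - 5).+1 = m by lia.
rewrite !nth_mid ?leq_pred // => lt_mid.
by have /lt_mid/N.ltb_lt : (m - 5).+1 < minn (k * k.+1 %/ 4).+1 (size (coefs k)) - 4; lia.
Qed.

Lemma d_increasing k : 12 <= k ->
  forall m, 5 <= m -> 4 * m <= k * k.+1 -> d k m.-1 < d k m.
Proof.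
elim: k => // k IH k12 m m5 mk.
case: (leqP k.+1 120) => k120.
  by apply: d_increasing_check => //; rewrite k12.
have {}IH : forall m, 5 <= m -> 4 * m <= k * k.+1 -> d k m.-1 < d k m.
  by apply: IH; lia.
(* Weak monotonicity also covers [i <= 4]; it serves the shifted term of the recurrence, whose index
   may be small. *)
have mono i : 4 * i <= k * k.+1 -> d k i.-1 <= d k i.
  case: (ltnP 4 i) => [i5 /(IH _ i5)/ltnW //|i5 _].
  have [d0 d1 d2 d3 d4] := d_small k.
  have k4 : 4 <= k by lia.
  move: i i5 => [|[|[|[|[|]]]]] //= _;
    by rewrite ?d0 ?d1 ?d2 ?d3 ?d4 // (leq_trans _ k4).
case: (leqP (4 * m) (k * k.+1)) => mk'.
  rewrite !d_recl -addSn leq_add ?IH //.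
  case: (leqP k.+1 m.-1) => km; last by [].
  rewrite (leq_trans km (leq_pred _)) (_ : m.-1 - k.+1 = (m - k.+1).-1); last by lia.
  by apply: mono; apply: leq_trans mk'; rewrite leq_mul2l leq_subr.
(* Here [k (k + 1) < 4 m <= (k + 1) (k + 2)], so [t = center (k + 1) - m + 1/2] lies between 1/2 and
   [(k + 2) / 2]. *)
case: m m5 mk mk' => // m _ mk mk' /=.
apply: d_increasing_near_center; first exact: leqW.
rewrite /center !S_INR.
have := le_INR _ _ (leP mk); have := lt_INR _ _ (ltP mk').
rewrite !mult_INR !S_INR /=; nra.
Qed.

(** * Classification of the equalities *)

Definition listed_up_to_symmetryb (k m : nat) : bool :=
  [|| listed k m, listed k ((max_weight k).+1 - m)
    | ((k %% 4 == 1) || (k %% 4 == 2)) && (2 * m == (max_weight k).+1)].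

Lemma listed_up_to_symmetryP k m :
  reflect (listed_up_to_symmetry k m) (listed_up_to_symmetryb k m).
Proof.
apply: (iffP or3P) => -[h|h|h]; try by [constructor 1|constructor 2];
  constructor 3.
  by case/andP: h => /orP[] /eqP -> /eqP; auto.
by case: h => -[] h /eqP ->; rewrite [k %% 4]h.
Qed.

Lemma d_eq_small k m : 1 <= k <= 11 -> 1 <= m <= max_weight k ->
  (d k m.-1 == d k m) = listed_up_to_symmetryb k m.
Proof.
pose c k m := N.to_nat (nth 0%num (coefs k) m).
have T : all (fun k => all (fun m => (c k m.-1 == c k m) == listed_up_to_symmetryb k m)
    (iota 1 (max_weight k))) (iota 1 11) by vm_compute.
move=> kb mb; rewrite !d_coefs.
have /(allP T)/allP/(_ m) : k \in iota 1 11 by rewrite mem_iota.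
by rewrite mem_iota add1n ltnS => /(_ mb)/eqP.
Qed.

Lemma listed_large k m : 12 <= k -> listed k m = (m \in [:: 1; 2; 4]).
Proof.
move=> k12; have lek j : j <= 12 -> j <= k by move/leq_trans; apply.
rewrite /listed !lek // (leqNgt k 11) k12 !inE /=.
by rewrite (gtn_eqF (lek 3 _)) // orbF.
Qed.

Lemma d_eq_large_le_center k m : 12 <= k -> 1 <= m -> 4 * m <= k * k.+1 ->
  (d k m.-1 == d k m) = listed k m.
Proof.
move=> k12 m1 mk; rewrite listed_large //.
have [d0 d1 d2 d3 d4] := d_small k.
have lek j : j <= 12 -> j <= k by move/leq_trans; apply.
case: (ltnP 4 m) => m5.
  rewrite ltn_eqF ?d_increasing //.
  by move: m5; case: m {m1 mk} => [|[|[|[|[|]]]]].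
by move: m m1 m5 {mk} => [|[|[|[|[|]]]]] //= _ _; rewrite ?d0 ?d1 ?d2 ?d3 ?d4 ?lek.
Qed.

(** If [k] is 0 or 3 modulo 4, then 4 divides [k (k + 1)] and [max_weight k] is even. *)
Lemma mod4_of_center k m : 2 * m = (max_weight k).+1 -> (k %% 4 == 1) || (k %% 4 == 2).
Proof.
move=> mid; have N2 := double_max_weight k.
have k4 := divn_eq k 4; have := ltn_pmod k (isT : 0 < 4).
case: (k %% 4) k4 => [|[|[|[|]]]] //= k4 _; exfalso.
  have : k * k.+1 = 4 * (k %/ 4 * k.+1) by rewrite {1}k4 addn0; lia.
  lia.
have : k * k.+1 = 4 * ((k %/ 4).+1 * k) by rewrite {2}k4; lia.
lia.
Qed.

Lemma d_eq_large k m : 12 <= k -> 1 <= m <= max_weight k ->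
  (d k m.-1 == d k m) = listed_up_to_symmetryb k m.
Proof.
move=> k12 /andP[m1 mN]; have N2 := double_max_weight k.
(* Large enough for the exceptional indices 1, 2, 4 and their reflections to lie on opposite sides
   of the middle. *)
have N40 : 78 <= max_weight k by nia.
have listed_gt4 j : 4 < j -> listed k j = false.
  by move=> j4; rewrite listed_large // !inE !gtn_eqF // (leq_trans _ j4).
rewrite /listed_up_to_symmetryb.
case: (leqP (4 * m) (k * k.+1)) => mk.
  rewrite d_eq_large_le_center // (listed_gt4 (_ - m)); last by lia.
  by rewrite (_ : (2 * m == _) = false) ?andbF ?orbF //; lia.
rewrite (listed_gt4 m) /=; last by lia.
(* Reflection reverses the order of the pair, hence [eq_sym]; [m'] satisfies [4 m' <= k (k + 1)]
   unless the pair is its own mirror image. *)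
rewrite eq_sym (d_symmetric mN) (@d_symmetric k m.-1); last by lia.
set m' := _.+1 - m.
have -> : max_weight k - m.-1 = m' by lia.
have -> : max_weight k - m = m'.-1 by lia.
case: (eqVneq (2 * m) (max_weight k).+1) => mid.
  rewrite (mod4_of_center mid) orbT.
  have em : m' = m by lia.
  rewrite (@d_symmetric k m'.-1); last by lia.
  by rewrite em (_ : max_weight k - m.-1 = m) ?eqxx; lia.
by rewrite andbF orbF d_eq_large_le_center //; lia.
Qed.

Theorem theorem4p6 :
  (forall k : nat, 1 <= k -> d k 0 = 1 /\ d k 1 = 1) /\
  ((forall k : nat, 2 <= k -> d k 2 = 1) /\ d 2 3 = 1 /\ d 3 4 = 1) /\
  (forall k : nat, 4 <= k -> d k 3 = 2 /\ d k 4 = 2) /\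
  (forall k m : nat, 4 <= k <= 11 -> m \in sporadic k ->
     4 * m <= k * k.+1 /\ d k m.-1 = d k m) /\
  (forall k m : nat, 12 <= k -> 5 <= m -> 4 * m <= k * k.+1 ->
     d k m.-1 < d k m) /\
  (forall k m : nat, 1 <= k -> m <= max_weight k ->
     d k m = d k (max_weight k - m)) /\
  (forall k m : nat, 1 <= k -> 1 <= m <= max_weight k ->
     (d k m.-1 = d k m <-> listed_up_to_symmetry k m)).
Proof.
refine (conj _ (conj (conj _ (conj _ _)) (conj _ (conj _ (conj _ (conj _ _)))))).
- by move=> k k1; have [-> -> ] := d_small k.
- by move=> k k2; have [_ _ ->] := d_small k.
- by rewrite !d_coefs.
- by rewrite !d_coefs.
- by move=> k k4; have [_ _ _ d3 d4] := d_small k; rewrite d3 ?d4 // ltnW.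
- have T : all (fun k => all (fun m => (4 * m <= k * k.+1) &&
      (N.to_nat (nth 0%num (coefs k) m.-1) == N.to_nat (nth 0%num (coefs k) m)))
    (sporadic k)) (iota 4 8) by vm_compute.
  move=> k m kb km.
  have /(allP T)/allP/(_ m km)/andP[? /eqP] : k \in iota 4 8 by rewrite mem_iota.
  by rewrite -!d_coefs.
- by move=> k m k12 m5; apply: d_increasing.
- by move=> k m _; apply: d_symmetric.
move=> k m k1 mb.
suff e : (d k m.-1 == d k m) = listed_up_to_symmetryb k m.
  split=> [/eqP h|/listed_up_to_symmetryP h].
    by apply/listed_up_to_symmetryP; rewrite -e.
  by apply/eqP; rewrite e.
case: (leqP k 11) => k11; last exact: d_eq_large.
by apply: d_eq_small; rewrite ?k1.
Qed.
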